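(* Let $K\ge 4$ and $L\ge 1$ be integers, and let $\mathbf{H}_{ij}\in\mathbb{R}^{L\times L}$ ($1\le i,j\le K$) be random diagonal matrices such that the joint distribution of the $LK^2$ diagonal entries $\{(\mathbf{H}_{ij})_{\ell\ell}\}_{i,j=1,\dots,K,\ \ell=1,\dots,L}$ has a density in $\mathbb{R}^{LK^2}$ (fast fading). Then, with probability $1$, the maximum sum degrees of freedom achievable with vector space interference alignment strategies satisfies \[ \mathrm{DoF}\le\frac{K}{2}\left(1-\frac{1}{11\sqrt{L}}\right). \]
   Context: For a matrix $\mathbf{H}\in\mathbb{R}^{L\times L}$ and a subspace $V\subseteq\mathbb{R}^L$, $\mathbf{H}V=\{\mathbf{H}\mathbf{v}:\mathbf{v}\in V\}$; sums of subspaces are spans of unions. Given the channel matrices $\{\mathbf{H}_{ij}\}$, a vector space strategy with parameter $D$ (a nonnegative integer) is a choice of subspaces $V_1,\dots,V_K\subseteq\mathbb{R}^L$, each of dimension $D$ ($V_i$ is the column span of the precoding matrix of transmitter $i$, which sends $D$ symbols; the subspaces may depend on the channel matrices). The decoding condition at receiver $i$ is \[ \mathbf{H}_{ii}V_i\cap\Bigl(\sum_{j\ne i}\mathbf{H}_{ij}V_j\Bigr)=\{0\}. \] The maximum sum (total) degrees of freedom is \[ \mathrm{DoF}=\max \frac{KD}{L}, \] the maximum being over all $D$ and all $\{V_i\}$ with $\dim V_i=D$ that satisfy the decoding condition at every receiver $i=1,\dots,K$. *)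

(* Defs.v *)
From HB Require Import structures.
From mathcomp Require Import all_boot all_order all_algebra.
From mathcomp Require Import all_classical all_reals all_analysis.

Set Implicit Arguments.
Unset Strict Implicit.
Unset Printing Implicit Defensive.

Import Order.TTheory GRing.Theory Num.Theory.
Import numFieldNormedType.Exports.

Local Open Scope classical_set_scope.
Local Open Scope ring_scope.

Section cons_lebesgue.
Variables (R : realType) (n : nat).

Definition tuple_of_pair (p : R * n.-tuple R) : n.+1.-tuple R :=
  [tuple of p.1 :: p.2].

Lemma measurable_tuple_of_pair : measurable_fun setT tuple_of_pair.
Proof. exact: measurable_cons. Qed.

Definition cons_rect (A : set R) (B : set (n.-tuple R)) :
    set (n.+1.-tuple R) :=
  [set t | A (thead t) /\ B [tuple of behead t]].

Lemma preimage_cons_rect (A : set R) (B : set (n.-tuple R)) :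
  tuple_of_pair @^-1` cons_rect A B = A `*` B.
Proof.
have beheadE (x : R) (t : n.-tuple R) : [tuple of behead (x :: t)] = t.
  exact/val_inj.
by apply/seteqP; split=> -[x t]; rewrite /cons_rect /= theadE beheadE.
Qed.

Lemma measurable_cons_rect (A : set R) (B : set (n.-tuple R)) :
  measurable A -> measurable B -> measurable (cons_rect A B).
Proof.
move=> mA mB; apply: measurableI.
  rewrite -[X in measurable X]setTI; exact: (measurable_tnth ord0).
rewrite -[X in measurable X]setTI; exact: measurable_behead.
Qed.

Variable mu : {sigma_finite_measure set (n.-tuple R) -> \bar R}.

Definition cons_lebesgue : set (n.+1.-tuple R) -> \bar R :=
  pushforward (lebesgue_measure \x mu)%E tuple_of_pair.

Let measurable_preimage (A : set (n.+1.-tuple R)) :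
  measurable A -> measurable (tuple_of_pair @^-1` A).
Proof.
by move=> mA; rewrite -[X in measurable X]setTI; exact: measurable_tuple_of_pair.
Qed.

Let cons_lebesgue0 : cons_lebesgue set0 = 0%E.
Proof. by rewrite /cons_lebesgue /pushforward preimage_set0 measure0. Qed.

Let cons_lebesgue_ge0 A : (0 <= cons_lebesgue A)%E.
Proof. exact: integral_ge0. Qed.

Let cons_lebesgue_sigma_additive : semi_sigma_additive cons_lebesgue.
Proof.
move=> F mF tF mUF; rewrite /cons_lebesgue /pushforward preimage_bigcup.
apply: measure_semi_sigma_additive.
- by move=> k; exact: measurable_preimage.
- apply/trivIsetP => /= i j _ _ ij; rewrite -preimage_setI.
  by move/trivIsetP : tF => /(_ _ _ _ _ ij) ->//; rewrite preimage_set0.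
- by rewrite -preimage_bigcup; exact: measurable_preimage.
Qed.

HB.instance Definition _ := isMeasure.Build _ _ _ cons_lebesgue
  cons_lebesgue0 cons_lebesgue_ge0 cons_lebesgue_sigma_additive.

Lemma cons_lebesgueE (A : set R) (B : set (n.-tuple R)) :
  measurable A -> measurable B ->
  cons_lebesgue (cons_rect A B) = (lebesgue_measure A * mu B)%E.
Proof.
move=> mA mB; rewrite /cons_lebesgue /pushforward preimage_cons_rect.
exact: product_measure1E.
Qed.

Let cons_lebesgue_sigma_finite : sigma_finite setT cons_lebesgue.
Proof.
have /sigma_finiteP[F [TF ndF Foo]] := sigma_finiteT (@lebesgue_measure R).
have /sigma_finiteP[G [TG ndG Goo]] := sigma_finiteT mu.
exists (fun k => cons_rect (F k) (G k)).
  apply/esym; rewrite -subTset => t _.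
  have : [set: R] (thead t) by [].
  rewrite TF => -[i _ Fi].
  have : [set: n.-tuple R] [tuple of behead t] by [].
  rewrite TG => -[j _ Gj].
  exists (maxn i j) => //; split.
    by move: Fi; exact/subsetPset/ndF/leq_maxl.
  by move: Gj; exact/subsetPset/ndG/leq_maxr.
move=> k; have [mF Fk] := Foo k; have [mG Gk] := Goo k.
split; first exact: measurable_cons_rect.
by rewrite cons_lebesgueE// lte_mul_pinfty// ge0_fin_numE.
Qed.

HB.instance Definition _ := Measure_isSigmaFinite.Build _ _ _ cons_lebesgue
  cons_lebesgue_sigma_finite.

End cons_lebesgue.

(* Lebesgue measure on R^n, as an iterated product of the measure on R. *)
Fixpoint tuple_lebesgue (R : realType) (n : nat) :
    {sigma_finite_measure set (n.-tuple R) -> \bar R} :=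
  match n with
  | 0 => \d_([tuple] : 0.-tuple R)
  | n'.+1 => cons_lebesgue (tuple_lebesgue R n')
  end.

Lemma tuple_lebesgue_box (R : realType) (n : nat) (A : 'I_n -> set R) :
  (forall i, measurable (A i)) ->
  tuple_lebesgue R n [set t | forall i, A i (tnth t i)] =
  (\prod_(i < n) lebesgue_measure (A i))%E.
Proof.
elim: n A => [|n IHn] A mA.
  rewrite big_ord0 /= diracE mem_set//= => -[]//.
rewrite big_ord_recl -IHn; last by move=> i; exact: mA.
rewrite /= -cons_lebesgueE; first last.
- rewrite (_ : [set _ | _] = \bigcap_(i in [set: 'I_n])
      ((@tnth n R)^~ i @^-1` A (lift ord0 i))); last first.
    apply/seteqP; split=> t /= At i => [_|]; first exact: At.
    exact: At i I.
  apply: fin_bigcap_measurable => // i _.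
  rewrite -[X in measurable X]setTI; exact: (measurable_tnth i).
- exact: mA.
congr (cons_lebesgue _ _); apply/seteqP; split=> t /= At.
  split=> [|i]; first exact: At.
  by have := At (lift ord0 i); rewrite {1}(tuple_eta t) tnthS.
move: At => [A0 At] i; have [j ->|->] := unliftP ord0 i; last exact: A0.
by rewrite (tuple_eta t) tnthS; exact: At.
Qed.

Definition has_density (R : realType) (d : measure_display)
    (Omega : measurableType d) (P : probability Omega R) (n : nat)
    (X : Omega -> n.-tuple R) : Prop :=
  exists f : n.-tuple R -> R,
    [/\ measurable_fun setT f,
        (forall t, 0 <= f t) &
        forall A : set (n.-tuple R), measurable A ->
          pushforward P X A = (\int[tuple_lebesgue R n]_(t in A) (f t)%:E)%E].

Section interference_alignment.
Variables (R : realType) (K L : nat).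
Implicit Types (H : 'I_K -> 'I_K -> 'M[R]_L) (V : 'I_K -> {vspace 'cV[R]_L}).

Definition diagonal_entries H : #|{: 'I_K * 'I_K * 'I_L}|.-tuple R :=
  codom_tuple (fun p : 'I_K * 'I_K * 'I_L => H p.1.1 p.1.2 p.2 p.2).

Definition mximg (A : 'M[R]_L) (U : {vspace 'cV[R]_L}) : {vspace 'cV[R]_L} :=
  (linfun (mulmx A) @: U)%VS.

Definition decodable H V (i : 'I_K) : Prop :=
  (mximg (H i i) (V i) :&: \sum_(j | j != i) mximg (H i j) (V j))%VS = 0%VS.

Definition achievable H (D : nat) : Prop :=
  exists V, (forall i, \dim (V i) = D) /\ (forall i, decodable H V i).

Definition achievable_dof H : set R :=
  [set x | exists2 D, achievable H D & x = (K * D)%:R / L%:R].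

Definition DoF H : R := sup (achievable_dof H).

Lemma achievable0 H : achievable H 0.
Proof.
exists (fun=> 0%VS); split=> i; first exact: dimv0.
by rewrite /decodable /mximg limg0 cap0v.
Qed.

Lemma achievable_leq H D : (0 < K)%N -> achievable H D -> (D <= L)%N.
Proof.
move=> K0 [V [dimV _]]; rewrite -(dimV (Ordinal K0)).
by have := dimvS (subvf (V (Ordinal K0))); rewrite dimvf /dim /= muln1.
Qed.

(* DoF is a genuine maximum: sup is not taken at its junk value. *)
Lemma DoF_max H : (0 < K)%N ->
  achievable_dof H (DoF H) /\ ubound (achievable_dof H) (DoF H).
Proof.
move=> K0.
have aP : exists D, `[< achievable H D >].
  by exists 0; apply/asboolP; exact: achievable0.
have aL D : `[< achievable H D >] -> (D <= L)%N.
  by move=> /asboolP; exact: achievable_leq.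
have [D /asboolP aD maxD] := ex_maxnP aP aL.
have ubD : ubound (achievable_dof H) ((K * D)%:R / L%:R).
  move=> _ [E aE ->]; rewrite ler_wpM2r ?invr_ge0// ler_nat leq_mul2l.
  by rewrite maxD ?orbT//; exact/asboolP.
suff -> : DoF H = (K * D)%:R / L%:R by split=> //; exists D.
apply/eqP; rewrite eq_le; apply/andP; split.
  by apply: ge_sup => //; exists ((K * D)%:R / L%:R), D.
by apply: ub_le_sup; [exists ((K * D)%:R / L%:R)|exists D].
Qed.

End interference_alignment.

(* Main.v *)
Require Import Defs.
From mathcomp Require Import all_boot all_order all_algebra.
From mathcomp Require Import all_classical all_reals all_analysis.
From mathcomp Require Import measurable_realfun zify ring lra.

(* Put delta = L - 2D. At each receiver the interfering signals fit in dimension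
   D + delta, so any two of them nearly coincide. Going from user 2 to users 1 and 3
   and back yields diagonal matrices T and S for which dim(V + TV) and dim(V + SV)
   are at most D + 2 delta, where V = V_2, and the direct link of user 2 yields a diagonal invertible G with
   dim(V cap GV) <= delta.

   Write d = 2 delta and let X be a smallest subspace of V which contains all v with
   v, Tv, ..., T^d v in V and such that x in X, Tx in V imply Tx in X, and likewise
   for S; then dim V - dim X <= d^2. Minimality forces
   X = (T - t)X' + (S - s)X'' for suitable scalars t, s, where X' = X cap T^-1 X and
   X'' = X cap S^-1 X. This identity pushes the sum U of all T^i S^j X with i, j <= n
   onto the two far edges of the box, whence dim U <= dim X + 2nd.

   When (n + 1)^2 >= L, for generic channels the monomials T^i S^j span all diagonal
   matrices, so U contains X + GX. Therefore D <= d^2 + 2nd + delta, and taking n about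
   sqrt L gives delta >= sqrt L / 11. The channels that are not generic lie in the zero
   set of a nonzero polynomial, which is Lebesgue-null. *)

Set Implicit Arguments.
Unset Strict Implicit.
Unset Printing Implicit Defensive.

Import Order.TTheory GRing.Theory Num.Theory.
Import numFieldNormedType.Exports.

Local Open Scope classical_set_scope.
Local Open Scope ring_scope.

(** * Subspaces nearly invariant under endomorphisms *)

Section NearInvariant.
Variables (F : numFieldType) (E : vectType F).
Implicit Types (X Y V W : {vspace E}) (f T S : 'End(E)).

(** Rank-nullity for [f] on [X] and on [X :&: f @^-1: W]: the kernels agree, and the second image is
    [W :&: f @: X]. *)
Lemma dim_cap_preim f X W :
  (\dim X + \dim W = \dim (X :&: f @^-1: W) + \dim (W + f @: X))%N.
Proof.
have kerE : (X :&: f @^-1: W :&: lker f = X :&: lker f)%VS.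
  apply/vspaceP => u; rewrite !memv_cap -memv_preim memv_ker.
  by case: eqP => [->|]; rewrite ?mem0v ?andbT ?andbF.
have imE : (f @: (X :&: f @^-1: W) = W :&: f @: X)%VS.
  apply/vspaceP => y; rewrite memv_cap; apply/idP/andP.
    move=> /memv_imgP[u]; rewrite memv_cap -memv_preim => /andP[uX uW] ->.
    by split=> //; exact: memv_img.
  move=> [yW /memv_imgP[u uX yE]]; rewrite yE; apply: memv_img.
  by rewrite memv_cap -memv_preim uX -yE.
have := limg_ker_dim f X; have := limg_ker_dim f (X :&: f @^-1: W)%VS.
rewrite kerE imE; have := dimv_sum_cap W (f @: X)%VS.
lia.
Qed.

(** The vectors v with v, Tv, ..., T^k v all in V. *)
Definition chain V T k := iter k (fun X => V :&: T @^-1: X)%VS V.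

Lemma chain_sub V T k : (chain V T k <= V)%VS.
Proof. by case: k => [|k]; [exact: subvv|exact: capvSl]. Qed.

(** Each further iterate costs at most [d] dimensions, by [dim_cap_preim] for [V] and the previous
    chain. *)
Lemma dim_chain V T d k : (\dim (V + T @: V) <= \dim V + d)%N ->
  (\dim V <= \dim (chain V T k) + k * d)%N.
Proof.
move=> Vd; elim: k => [|k IHk]; first by rewrite mul0n addn0.
have /= := dim_cap_preim T V (chain V T k).
have : (\dim (chain V T k + T @: V) <= \dim (V + T @: V))%N.
  by apply/dimvS/addvS => //; exact: chain_sub.
rewrite mulSn; lia.
Qed.

Definition closed_in V T X :=
  forall x, x \in X -> T x \in V -> T x \in X.

(** Closedness gives [X :&: T @^-1: X = X :&: T @^-1: V], so the defect of [V] bounds that of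
    [X]. *)
Lemma dim_closed V T d X : (\dim (V + T @: V) <= \dim V + d)%N ->
  (X <= V)%VS -> closed_in V T X ->
  (\dim X <= \dim (X :&: T @^-1: X) + d)%N.
Proof.
move=> Vd XV cX; have := dim_cap_preim T X V.
have -> : (X :&: T @^-1: V = X :&: T @^-1: X)%VS.
  apply/vspaceP => x; rewrite !memv_cap -!memv_preim.
  have [xX /=|//] := boolP (x \in X).
  by apply/idP/idP => [/cX->//|/(subvP XV)].
have : (\dim (V + T @: X) <= \dim (V + T @: V))%N.
  by apply/dimvS/addvS => //; exact: limgS.
lia.
Qed.

Lemma dim_add_closed V T d X : (\dim (V + T @: V) <= \dim V + d)%N ->
  (X <= V)%VS -> closed_in V T X -> (\dim (X + T @: X) <= \dim X + d)%N.
Proof.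
move=> Vd XV cX; have := dim_closed Vd XV cX.
have := dim_cap_preim T X X; lia.
Qed.

Lemma chain_iter V T X k x i : closed_in V T X -> (chain V T k <= X)%VS ->
  x \in chain V T k -> (i <= k)%N -> iter i T x \in X.
Proof.
move=> cX kX xk ik.
(* Membership in [chain V T (k - i)] is carried along because it puts the next iterate in [V], as
   [cX] demands. *)
have H : iter i T x \in chain V T (k - i) /\ iter i T x \in X.
  elim: i ik => [|i IHi] ik; first by rewrite subn0 /=; split=> //; exact: (subvP kX).
  have [] := IHi (ltnW ik); rewrite subnS; move: ik; rewrite -subn_gt0.
  case: (k - i)%N => //= j _; rewrite memv_cap -memv_preim => /andP[_ xj] xX.
  by split=> //; apply: cX => //; exact: (subvP (chain_sub _ _ _)) xj.
by case: H.
Qed.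

(** The quotient X/Y has dimension at most [d]; it is modelled by a complement [C] of [Y] in [X],
    onto which the vectors are projected along [Y]. *)
Lemma lin_dep_mod X Y d (x : 'I_d.+1 -> E) : (Y <= X)%VS ->
  (\dim X <= \dim Y + d)%N -> (forall i, x i \in X) ->
  exists2 c : 'I_d.+1 -> F, \sum_i c i *: x i \in Y & exists i, c i != 0.
Proof.
move=> YX dXY xX; pose C := (X :\: Y)%VS.
have YC0 : (Y :&: C = 0)%VS by rewrite capvC /C capv_diff.
have dC : (\dim C <= d)%N.
  by have := dimv_cap_compl X Y; rewrite (capv_idPr YX); rewrite -/C; lia.
have xYC i : x i \in (Y + C)%VS.
  by rewrite addvC addv_diff; apply: (subvP (addvSl _ _)).
pose y := [tuple daddv_pi C Y (x i) | i < d.+1].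
have : ~~ free y.
  apply/negP; rewrite /free => /eqP yd.
  suff : (d.+1 <= d)%N by rewrite ltnn.
  rewrite -{1}[d.+1](size_tuple y) -yd; apply: leq_trans dC; apply/dimvS.
  by apply/span_subvP => _ /mapP[i _ ->]; exact: memv_pi.
move=> /freeP yNfree.
have [c [cy [i ci]]] : exists c : 'I_d.+1 -> F,
    \sum_i c i *: y`_i = 0 /\ exists i, c i != 0.
  apply: contrapT => nc; apply: yNfree => c cy i; apply/eqP/negPn/negP => ci.
  by apply: nc; exists c; split=> //; exists i.
exists c; last by exists i.
have sE : \sum_i c i *: y`_i = daddv_pi C Y (\sum_i c i *: x i).
  rewrite linear_sum; apply: eq_bigr => j _.
  by rewrite linearZ /= (nth_map j) ?size_enum_ord// nth_ord_enum.
have sYC : \sum_i c i *: x i \in (Y + C)%VS.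
  by apply: rpred_sum => j _; apply: rpredZ.
have := daddv_pi_add YC0 sYC; rewrite -sE cy addr0 => <-; exact: memv_pi.
Qed.

Lemma ex_nonroot (p : {poly F}) : p != 0 -> exists x, p.[x] != 0.
Proof.
move=> p0; pose s := [seq n%:R : F | n <- iota 0 (size p)].
have us : uniq s.
  by rewrite map_inj_uniq ?iota_uniq// => m n /eqP; rewrite eqr_nat => /eqP.
have [/allP rs|/allPn[x _ px]] := boolP (all (root p) s); last by exists x.
have := max_poly_roots p0 (introT allP rs) us.
by rewrite size_map size_iota ltnn.
Qed.

Lemma mem_scale (c : F) (x : E) X : c != 0 -> c *: x \in X -> x \in X.
Proof. by move=> c0 /(memvZ c^-1); rewrite scalerA mulVf// scale1r. Qed.

Definition shift T (t : F) : 'End(E) := (T - t *: \1)%VF.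

Lemma shiftE T t x : shift T t x = T x - t *: x.
Proof. by rewrite /shift lfunE /= lfunE /= lfunE /= id_lfunE. Qed.

Lemma img_dim_inj f X : lker f = 0%VS -> \dim (f @: X) = \dim X.
Proof. by move=> f0; rewrite limg_dim_eq// f0 capv0. Qed.

(* Modulo (S - s)X'' the d + 1 vectors T^i v, i <= d, are dependent, and a relation
   p(T) v = 0 turns into p(t) v = 0 modulo (T - t)X'. *)
Lemma chain_corner V T S X d s :
  (chain V T d <= X)%VS -> closed_in V T X ->
  (\dim X <= \dim (X :&: S @^-1: X) + d)%N -> lker (shift S s) = 0%VS ->
  (shift S s @: (X :&: S @^-1: X) <= X)%VS ->
  exists2 p : {poly F}, p != 0 & forall t, p.[t] != 0 ->
    (chain V T d <=
      shift T t @: (X :&: T @^-1: X) + shift S s @: (X :&: S @^-1: X))%VS.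
Proof.
move=> CX cX dX s0 sX; pose Y := (shift S s @: (X :&: S @^-1: X))%VS.
have dY : (\dim X <= \dim Y + d)%N by rewrite img_dim_inj.
have vecP v : v \in chain V T d -> exists2 p : {poly F}, p != 0 &
    forall t, p.[t] != 0 -> v \in (shift T t @: (X :&: T @^-1: X) + Y)%VS.
  move=> vC; have itX (i : 'I_d.+1) : iter i T v \in X.
    by apply: (chain_iter cX CX vC); rewrite -ltnS.
  have [c cY [i ci]] := lin_dep_mod sX dY itX.
  exists (\poly_(j < d.+1) c (inord j)).
    apply/eqP => /polyP /(_ i); rewrite coef_poly ltn_ord coef0 inord_val.
    exact/eqP.
  move=> t pt; apply: (mem_scale pt).
  (* The difference telescopes into [shift T t] applied to combinations of iterates that lie in [X]
     together with their images under [T]. *)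
  have diffZ j : (j <= d)%N ->
      iter j T v - t ^+ j *: v \in (shift T t @: (X :&: T @^-1: X))%VS.
    elim: j => [|j IHj] jd; first by rewrite expr0 scale1r subrr mem0v.
    have -> : iter j.+1 T v - t ^+ j.+1 *: v =
        shift T t (iter j T v) + t *: (iter j T v - t ^+ j *: v).
      by rewrite shiftE /= scalerBr scalerA -exprS addrA subrK.
    apply: rpredD; last by apply: rpredZ; exact: IHj (ltnW jd).
    apply: memv_img; rewrite memv_cap -memv_preim.
    rewrite (itX (Ordinal (ltnW jd : j < d.+1)%N)).
    exact: (itX (Ordinal (jd : j.+1 < d.+1)%N)).
  rewrite horner_poly.
  have -> : (\sum_(j < d.+1) c (inord j) * t ^+ j) *: v =
     \sum_(j < d.+1) - (c j *: (iter j T v - t ^+ j *: v)) +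
     \sum_(j < d.+1) c j *: iter j T v.
    rewrite -big_split scaler_suml; apply: eq_bigr => j _ /=.
    by rewrite inord_val scalerBr opprB subrK scalerA.
  apply: memv_add => //; apply: rpred_sum => j _; rewrite rpredN; apply: rpredZ.
  by apply: diffZ; rewrite -ltnS.
have [k|p /all_and2[p0 pP]] := @choice _ _
    (fun (k : 'I_(\dim (chain V T d))) (q : {poly F}) => q != 0 /\
      forall t, q.[t] != 0 -> (vbasis (chain V T d))`_k \in
        (shift T t @: (X :&: T @^-1: X) + Y)%VS).
  have [|q q0 qP] := vecP (vbasis (chain V T d))`_k; last by exists q.
  by apply: vbasis_mem; rewrite mem_nth// size_tuple.
(* Where the product is nonzero so is each factor, hence one polynomial serves a whole basis of the
   chain. *)
exists (\prod_k p k); first by apply/prodf_neq0 => k _; exact: p0.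
move=> t; rewrite horner_prod => /prodf_neq0 pt.
rewrite -(span_basis (vbasisP (chain V T d))); apply/span_subvP => x.
move=> /(nthP 0)[k]; rewrite size_tuple => kd <-.
by have := pP (Ordinal kd) t (pt (Ordinal kd) isT).
Qed.

(** Among the closed subspaces of [V] containing the chain, [X] has least dimension. The sum [Z] of
    the two shifted images lies in [X] and is again such a subspace, so [Z = X]. *)
Lemma ex_generic_core V T S d (cT cS : {poly F}) :
  (\dim (V + T @: V) <= \dim V + d)%N -> (\dim (V + S @: V) <= \dim V + d)%N ->
  cT != 0 -> (forall t, cT.[t] != 0 -> lker (shift T t) = 0%VS) ->
  cS != 0 -> (forall s, cS.[s] != 0 -> lker (shift S s) = 0%VS) ->
  exists X t s,
    [/\ (X <= V)%VS, (\dim V <= \dim X + d * d)%N,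
        (\dim (X + T @: X) <= \dim X + d)%N /\
        (\dim (X + S @: X) <= \dim X + d)%N,
        lker (shift T t) = 0%VS /\ lker (shift S s) = 0%VS &
        (X <= shift T t @: X + shift S s @: X)%VS].
Proof.
move=> VT VS cT0 cTP cS0 cSP.
pose good k := exists X, [/\ (X <= V)%VS, (chain V T d <= X)%VS,
  closed_in V T X, closed_in V S X & \dim X = k].
have exg : exists k, `[< good k >].
  exists (\dim V); apply/asboolP; exists V; split=> //.
  exact: chain_sub.
have [k /asboolP[X [XV CX cXT cXS dX]] kmin] := ex_minnP exg.
have [s cs] := ex_nonroot cS0; have ks := cSP s cs.
have shiftX f (u : F) : (shift f u @: (X :&: f @^-1: X) <= X)%VS.
  apply/subvP => y /memv_imgP[x]; rewrite memv_cap -memv_preim => /andP[xX fxX] ->.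
  by rewrite shiftE rpredB// rpredZ.
have [p p0 pP] := chain_corner CX cXT (dim_closed VS XV cXS) ks (shiftX _ _).
(* [p] depends on [s], so [t] is chosen second; it must avoid the roots of both [cT] and [p]. *)
have [t] := ex_nonroot (mulf_neq0 cT0 p0).
rewrite hornerM mulf_eq0 negb_or => /andP[ct pt].
pose Z := (shift T t @: (X :&: T @^-1: X) + shift S s @: (X :&: S @^-1: X))%VS.
have ZX : (Z <= X)%VS by rewrite /Z subv_add !shiftX.
have ZE : Z = X.
  apply/eqP; rewrite -(dimv_leqif_eq ZX) eqn_leq dimvS//= dX.
  apply: kmin; apply/asboolP; exists Z; split=> //.
  - exact: subv_trans XV.
  - exact: pP.
  - move=> x xZ Tx; have xX := subvP ZX _ xZ.
    rewrite -[T x](subrK (t *: x)) -shiftE; apply: rpredD; last exact: rpredZ.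
    apply: (subvP (addvSl _ _)); apply: memv_img.
    by rewrite memv_cap -memv_preim xX cXT.
  - move=> x xZ Sx; have xX := subvP ZX _ xZ.
    rewrite -[S x](subrK (s *: x)) -shiftE; apply: rpredD; last exact: rpredZ.
    apply: (subvP (addvSr _ _)); apply: memv_img.
    by rewrite memv_cap -memv_preim xX cXS.
exists X, t, s; split=> //.
- apply: leq_trans (dim_chain d VT) _; rewrite leq_add2r; exact: dimvS.
- split; [exact: (dim_add_closed VT)|exact: (dim_add_closed VS)].
- by split=> //; exact: cTP.
- by rewrite -{1}ZE; apply: addvS; apply: limgS; exact: capvSl.
Qed.

(** * Growth of a subspace under powers of one or two endomorphisms *)

Definition grow T n X := iter n (fun Y => Y + T @: Y)%VS X.

Lemma grow_sub T n X : (X <= grow T n X)%VS.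
Proof.
elim: n => [|n IHn]; first exact: subvv.
exact: subv_trans IHn (addvSl _ _).
Qed.

Lemma grow_iter T n i X x : (i <= n)%N -> x \in X -> iter i T x \in grow T n X.
Proof.
elim: n i => [|n IHn] [|i]//= ni xX.
  by apply: (subvP (addvSl _ _)); exact: (IHn 0%N).
by apply: (subvP (addvSr _ _)); apply: memv_img; exact: IHn.
Qed.

(** The increments never increase: for Y = Z + TZ, both Y and TY contain TZ, and dim TY - dim TZ <=
    dim Y - dim Z. *)
Lemma dim_grow T n X d : (\dim (X + T @: X) <= \dim X + d)%N ->
  (\dim (grow T n X) <= \dim X + n * d)%N.
Proof.
move=> Xd; elim: n => [|n IHn]; first by rewrite addn0.
have step : (\dim (grow T n.+1 X) <= \dim (grow T n X) + d)%N.
  elim: n {IHn} => [//|n IHn]; rewrite [grow T n.+2 X]/grow iterS -/(grow T n.+1 X).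
  set Y := grow T n.+1 X in IHn *; set Z := grow T n X in IHn *.
  have YE : Y = (Z + T @: Z)%VS by [].
  have : (\dim (Y + T @: Y) + \dim (T @: Z) <= \dim Y + \dim (T @: Y))%N.
    rewrite -(dimv_sum_cap Y) leq_add2l; apply: dimvS.
    by rewrite subv_cap {1}YE addvSr limgS// YE addvSl.
  have := limg_ker_dim T Y; have := limg_ker_dim T Z.
  have : (\dim (Z :&: lker T) <= \dim (Y :&: lker T))%N.
    by apply/dimvS/capvS => //; rewrite YE addvSl.
  lia.
rewrite mulSn; lia.
Qed.

(** Y + (T - t)Y = Y + TY for every Y. This allows [T] to be replaced by an injective shift. *)
Lemma grow_shift T t n X : grow (shift T t) n X = grow T n X.
Proof.
elim: n => //= n ->; set Y := grow T n X.
apply/eqP; rewrite eqEsubv !subv_add !addvSl /=.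
apply/andP; split; apply/subvP => _ /memv_imgP[x xY ->].
  rewrite shiftE; apply: rpredB; first by apply: (subvP (addvSr _ _)); exact: memv_img.
  by apply: (subvP (addvSl _ _)); exact: rpredZ.
rewrite -[T x](subrK (t *: x)) -shiftE; apply: rpredD.
  by apply: (subvP (addvSr _ _)); exact: memv_img.
by apply: (subvP (addvSl _ _)); exact: rpredZ.
Qed.

Definition commutes T S := forall x, T (S x) = S (T x).

Definition pimg T n X := iter n (fun Y => T @: Y)%VS X.

Lemma pimgS T n X Y : (X <= Y)%VS -> (pimg T n X <= pimg T n Y)%VS.
Proof. by move=> XY; elim: n => //= n; exact: limgS. Qed.

Lemma pimgSr T n X : pimg T n (T @: X) = pimg T n.+1 X.
Proof. by rewrite /pimg iterSr. Qed.

Lemma pimgD T n X Y : pimg T n (X + Y) = (pimg T n X + pimg T n Y)%VS.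
Proof. by elim: n => //= n ->; rewrite limgD. Qed.

Lemma pimg_sum T n (I : Type) (r : seq I) (P : pred I) (X : I -> {vspace E}) :
  pimg T n (\sum_(i <- r | P i) X i) = (\sum_(i <- r | P i) pimg T n (X i))%VS.
Proof. by elim: n => //= n ->; rewrite limg_sum. Qed.

Lemma commutes_img T S X : commutes T S -> (T @: (S @: X) = S @: (T @: X))%VS.
Proof.
move=> TS; rewrite -!limg_comp; congr (_ @: _)%VS.
by apply/lfunP => x; rewrite !comp_lfunE.
Qed.

Lemma commutes_pimg T S n X : commutes T S ->
  pimg T n (S @: X) = (S @: pimg T n X)%VS.
Proof. by move=> TS; elim: n => //= n ->; rewrite commutes_img. Qed.

Lemma commutes_pimg2 T S n m X : commutes T S ->
  pimg T n (pimg S m X) = pimg S m (pimg T n X).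
Proof. by move=> TS; elim: m => //= m <-; rewrite commutes_pimg. Qed.

Lemma dim_pimg T n X : lker T = 0%VS -> \dim (pimg T n X) = \dim X.
Proof. by move=> T0; elim: n => //= n <-; rewrite img_dim_inj. Qed.

Lemma pimg_grow T i n X : (i <= n)%N -> (pimg T i X <= grow T n X)%VS.
Proof.
elim: n i => [|n IHn] [|i] //= ni; first exact: subv_trans (IHn 0%N _) (addvSl _ _).
exact: subv_trans (limgS _ (IHn i ni)) (addvSr _ _).
Qed.

Lemma grow_sum T n X : grow T n X = (\sum_(i < n.+1) pimg T i X)%VS.
Proof.
apply/eqP; rewrite eqEsubv; apply/andP; split; last first.
  by apply/subv_sumP => i _; apply: pimg_grow; rewrite -ltnS.
elim: n => [|n IHn]; first by rewrite big_ord1 subvv.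
rewrite /= subv_add; apply/andP; split; apply: (subv_trans _).
- exact: IHn.
- by rewrite [X in (_ <= X)%VS]big_ord_recr addvSl.
- exact: limgS IHn.
- by rewrite limg_sum [X in (_ <= X)%VS]big_ord_recl addvSr.
Qed.

(* The hypothesis [X <= T X + S X] trades each monomial T^i S^j for monomials of
   larger degree, so that only the edges i = n and j = m of the box contribute. *)
Lemma dim_grow2 T S n m X d : commutes T S ->
  lker T = 0%VS -> lker S = 0%VS -> (X <= T @: X + S @: X)%VS ->
  (\dim (X + T @: X) <= \dim X + d)%N -> (\dim (X + S @: X) <= \dim X + d)%N ->
  (\dim (grow T n (grow S m X)) <= \dim X + (n + m) * d)%N.
Proof.
move=> TS T0 S0 XTS XT XS.
set A := pimg T n (grow S m X); set B := pimg S m (grow T n X).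
(* [k] bounds the distance from (i, j) to the corner (n, m), which drops when either exponent is
   raised. *)
have box k i j : (n - i + (m - j) <= k)%N -> (i <= n)%N -> (j <= m)%N ->
    (pimg T i (pimg S j X) <= A + B)%VS.
  elim: k i j => [|k IHk] i j kij ni mj;
    (have [->|ni'] := eqVneq i n;
      [by apply: subv_trans (addvSl _ _); apply/pimgS/pimg_grow|]);
    (have [->|mj'] := eqVneq j m;
      [by rewrite commutes_pimg2//; apply: subv_trans (addvSr _ _);
       apply/pimgS/pimg_grow|]).
    by lia.
  apply: subv_trans (pimgS _ _ (pimgS _ _ XTS)) _.
  rewrite !pimgD subv_add; apply/andP; split.
    rewrite (@commutes_pimg S T) => [|x]; last by rewrite TS.
    by rewrite pimgSr; apply: IHk; lia.
  by rewrite pimgSr; apply: IHk; lia.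
have UAB : (grow T n (grow S m X) <= A + B)%VS.
  rewrite grow_sum; apply/subv_sumP => i _; rewrite grow_sum pimg_sum.
  apply/subv_sumP => j _; have := ltn_ord i; have := ltn_ord j => jm im.
  by apply: (box (n + m)%N); lia.
have dA : (\dim A <= \dim X + m * d)%N by rewrite dim_pimg//; exact: dim_grow.
have dB : (\dim B <= \dim X + n * d)%N by rewrite dim_pimg//; exact: dim_grow.
(* [A] and [B] share the corner T^n S^m X, a copy of X, so dim X is counted only once in dim(A +
   B). *)
have dAB : (\dim X <= \dim (A :&: B))%N.
  rewrite -(dim_pimg m X S0) -(dim_pimg n _ T0); apply: dimvS.
  rewrite subv_cap; apply/andP; split; first by apply/pimgS/pimg_grow.
  by rewrite commutes_pimg2//; apply/pimgS/pimg_grow.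
have := dimv_sum_cap A B; have := dimvS UAB; lia.
Qed.

(** [dim_grow2] applies to the shifts, which are injective and commute; [grow_shift] returns the
    bound to [T] and [S]. *)
Lemma ex_box_core V T S d (cT cS : {poly F}) : commutes T S ->
  (\dim (V + T @: V) <= \dim V + d)%N -> (\dim (V + S @: V) <= \dim V + d)%N ->
  cT != 0 -> (forall t, cT.[t] != 0 -> lker (shift T t) = 0%VS) ->
  cS != 0 -> (forall s, cS.[s] != 0 -> lker (shift S s) = 0%VS) ->
  exists X, [/\ (X <= V)%VS, (\dim V <= \dim X + d * d)%N &
    forall n m, (\dim (grow T n (grow S m X)) <= \dim X + (n + m) * d)%N].
Proof.
move=> TS VT VS cT0 cTP cS0 cSP.
have [X [t [s [XV dX [XT XS] [t0 s0] Xts]]]] :=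
  ex_generic_core VT VS cT0 cTP cS0 cSP.
exists X; split=> // n m; rewrite -(grow_shift T t) -(grow_shift S s).
have shiftD f u : (X + shift f u @: X = X + f @: X)%VS := grow_shift f u 1 X.
apply: dim_grow2 => //; rewrite ?shiftD//.
move=> x; rewrite !shiftE.
have lin f (a b : E) u : f (a - u *: b) = f a - u *: f b by rewrite linearB linearZ.
rewrite !lin TS !scalerBr !opprB !scalerA [s * t]mulrC addrACA [RHS]addrACA.
by congr (_ + _); exact: addrC.
Qed.

(** [X] and [f @: X] have equal dimension and both lie in [U], so they overlap in at least 2 dim X -
    dim U dimensions. *)
Lemma dim_cap_core V X U f : (X <= V)%VS -> (X <= U)%VS -> (f @: X <= U)%VS ->
  lker f = 0%VS -> (\dim X + \dim X <= \dim (V :&: f @: V) + \dim U)%N.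
Proof.
move=> XV XU fXU f0; have := dimv_sum_cap X (f @: X)%VS; rewrite (img_dim_inj _ f0).
have : (\dim (X + f @: X) <= \dim U)%N by apply: dimvS; rewrite subv_add XU.
have : (\dim (X :&: f @: X) <= \dim (V :&: f @: V))%N.
  by apply/dimvS/capvS => //; exact: limgS.
lia.
Qed.

End NearInvariant.

(** * Diagonal matrices, and alignment of two transmitters *)

Section Diagonal.
Variables (R : numFieldType) (L : nat).
Implicit Types (a b t s : 'I_L -> R) (x : 'cV[R]_L) (V W X : {vspace 'cV[R]_L}).

Definition dg a : 'End('cV[R]_L) := linfun (mulmx (diag_mx (\row_l a l))).

Lemma dgE a x l : dg a x l 0 = a l * x l 0.
Proof. by rewrite lfunE /= mul_diag_mx !mxE. Qed.

Lemma dg_commutes a b : commutes (dg a) (dg b).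
Proof. by move=> x; apply/colP => l; rewrite !dgE mulrCA. Qed.

Lemma dgM a b X : (dg a @: (dg b @: X) = dg (fun l => a l * b l) @: X)%VS.
Proof.
rewrite -limg_comp; congr (_ @: _)%VS; apply/lfunP => x.
by rewrite comp_lfunE; apply/colP => l; rewrite !dgE mulrA.
Qed.

Lemma eq_dg a b X : a =1 b -> (dg a @: X = dg b @: X)%VS.
Proof.
move=> ab; congr (_ @: _)%VS; apply/lfunP => x.
by apply/colP => l; rewrite !dgE ab.
Qed.

Lemma lker_shift_dg a (t : R) : (forall l, a l != t) -> lker (shift (dg a) t) = 0%VS.
Proof.
move=> at0; apply/eqP; rewrite -subv0; apply/subvP => x.
rewrite memv_ker shiftE => /eqP ax; rewrite memv0; apply/eqP/colP => l.
have := congr1 (fun y : 'cV_L => y l 0) ax.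
rewrite !mxE -/(dg a) dgE -mulrBl => /eqP.
by rewrite mulf_eq0 subr_eq0 (negbTE (at0 l)) => /eqP.
Qed.

Lemma lker_dg a : (forall l, a l != 0) -> lker (dg a) = 0%VS.
Proof.
by move=> /lker_shift_dg; rewrite /shift scale0r subr0.
Qed.

Lemma dim_dg a X : (forall l, a l != 0) -> \dim (dg a @: X) = \dim X.
Proof. by move=> /lker_dg; exact: img_dim_inj. Qed.

Lemma ex_shift_poly a : exists2 p : {poly R}, p != 0 &
  forall t : R, p.[t] != 0 -> lker (shift (dg a) t) = 0%VS.
Proof.
exists (\prod_l ('X - (a l)%:P)).
  by apply/prodf_neq0 => l _; rewrite polyXsubC_eq0.
move=> t; rewrite horner_prod => /prodf_neq0 at0; apply: lker_shift_dg => l.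
by have := at0 l isT; rewrite hornerXsubC subr_eq0 eq_sym.
Qed.

(** The monomials t^i s^j span the indicator of each coordinate. The index [k] encodes (i, j) in
    base n + 1, and i, j <= n once L <= (n + 1)^2. *)
Definition interpolating n t s := forall l, exists c : 'I_L -> R, forall l',
  \sum_(k < L) c k * (t l' ^+ (k %% n.+1) * s l' ^+ (k %/ n.+1)) = (l' == l)%:R.

Lemma iter_dg n a x l : iter n (dg a) x l 0 = a l ^+ n * x l 0.
Proof.
by elim: n => [|n IHn] /=; rewrite ?expr0 ?mul1r// dgE IHn mulrA -exprS.
Qed.

(** The interpolating combination of monomials in [dg t] and [dg s] is the projection to coordinate
    [l]. *)
Lemma delta_grow2 n t s X x l : (L <= n.+1 * n.+1)%N -> interpolating n t s ->
  x \in X -> x l 0 != 0 ->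
  delta_mx l 0 \in grow (dg t) n (grow (dg s) n X).
Proof.
move=> Ln /(_ l)[c cP] xX xl; set U := grow _ _ _.
apply: (mem_scale (c := x l 0)) => //.
have -> : x l 0 *: delta_mx l 0 = \sum_(k < L)
    c k *: iter (k %% n.+1) (dg t) (iter (k %/ n.+1) (dg s) x) :> 'cV[R]_L.
  apply/colP => l'; rewrite summxE !mxE eqxx andbT.
  have -> : x l 0 * (l' == l)%:R = x l' 0 * (l' == l)%:R.
    by case: eqP => [->|] //; rewrite !mulr0.
  by rewrite -cP mulr_sumr; apply: eq_bigr => k _; rewrite mxE !iter_dg; ring.
apply: rpred_sum => k _; apply: rpredZ; apply: grow_iter.
  by rewrite -ltnS ltn_pmod.
apply: grow_iter => //; rewrite -ltnS ltn_divLR//.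
exact: leq_trans Ln.
Qed.

(** The box contains the basis vector of every coordinate where some element of [X] is nonzero,
    hence the image of [X] under any diagonal matrix. *)
Lemma dg_sub_grow2 n t s g X : (L <= n.+1 * n.+1)%N -> interpolating n t s ->
  (dg g @: X <= grow (dg t) n (grow (dg s) n X))%VS.
Proof.
move=> Ln ts; apply/subvP => y /memv_imgP[x xX ->].
rewrite [dg g x]matrix_sum_delta; apply: rpred_sum => l _.
rewrite big_ord1 dgE; have [->|xl] := eqVneq (x l 0) 0.
  by rewrite mulr0 scale0r mem0v.
by apply: rpredZ; exact: (delta_grow2 (x := x)).
Qed.

Lemma dim_le_cap_dg n d t s g V : (L <= n.+1 * n.+1)%N ->
  interpolating n t s -> (forall l, g l != 0) ->
  (\dim (V + dg t @: V) <= \dim V + d)%N ->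
  (\dim (V + dg s @: V) <= \dim V + d)%N ->
  (\dim V <= \dim (V :&: dg g @: V) + d * d + (n + n) * d)%N.
Proof.
move=> Ln ts g0 Vt Vs.
have [cT cT0 cTP] := ex_shift_poly t; have [cS cS0 cSP] := ex_shift_poly s.
have [X [XV dX /(_ n n)]] :=
  ex_box_core (dg_commutes t s) Vt Vs cT0 cTP cS0 cSP.
set U := grow _ _ _ => dU.
have XU : (X <= U)%VS by exact: subv_trans (grow_sub _ _ _) (grow_sub _ _ _).
have gXU : (dg g @: X <= U)%VS by exact: dg_sub_grow2.
have cXU := dim_cap_core XV XU gXU (lker_dg g0).
have arith (v x u c p q : nat) :
    (x + x <= c + u -> v <= x + p -> u <= x + q -> v <= c + p + q)%N by lia.
exact: arith cXU dX dU.
Qed.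

(** The factor b/b' turns b'W into bW at the second receiver. The two sums then share bW, of
    dimension dim V, so together they span at most dim V + 2d; they contain aV and acV, where c is
    the ratio in the conclusion. *)
Lemma dim_loop a b a' b' V W d : (forall l, a l != 0) -> (forall l, b l != 0) ->
  (forall l, b' l != 0) -> \dim W = \dim V ->
  (\dim (dg a @: V + dg b @: W) <= \dim V + d)%N ->
  (\dim (dg a' @: V + dg b' @: W) <= \dim V + d)%N ->
  (\dim (V + dg (fun l => (b l * a' l) / (a l * b' l)) @: V)
    <= \dim V + (d + d))%N.
Proof.
move=> a0 b0 b'0 WV Va Vb.
pose e l := b l / b' l.
have e0 l : e l != 0 by rewrite mulf_neq0 ?invr_eq0.
set c := fun l => _.
pose A := (dg a @: V + dg b @: W)%VS.
pose B := (dg e @: (dg a' @: V + dg b' @: W))%VS.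
have BE : B = (dg (fun l => a l * c l) @: V + dg b @: W)%VS.
  rewrite /B limgD !dgM; congr (_ + _)%VS; apply: eq_dg => l; rewrite /e /c.
    by field; rewrite a0 b'0.
  by field; rewrite b'0.
have -> : \dim (V + dg c @: V) = \dim (dg a @: V + dg (fun l => a l * c l) @: V).
  by rewrite -dgM -limgD dim_dg.
have dB : (\dim B <= \dim V + d)%N by rewrite /B dim_dg.
have : (\dim (dg a @: V + dg (fun l => a l * c l) @: V) <= \dim (A + B))%N.
  by apply/dimvS/addvS; rewrite ?BE addvSl.
have : (\dim V <= \dim (A :&: B))%N.
  by rewrite -WV -(dim_dg W b0); apply: dimvS; rewrite subv_cap addvSr BE addvSr.
move=> dAB dABle.
have dA : (\dim A <= \dim V + d)%N by [].
have := dimv_sum_cap A B; clear -dA dB dAB dABle; lia.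
Qed.

(** Rescaling the near coincidence of aV and bW by b'/b shows that b'W contains all but d dimensions
    of a'gV. The subspace a'(V cap gV) of a'gV also lies in a'V, so it meets b'W only in 0. *)
Lemma dim_cap_direct a b a' b' V W d : (forall l, a l != 0) -> (forall l, b l != 0) ->
  (forall l, a' l != 0) -> (forall l, b' l != 0) -> \dim W = \dim V ->
  (\dim (dg a @: V + dg b @: W) <= \dim V + d)%N ->
  (dg a' @: V :&: dg b' @: W = 0)%VS ->
  (\dim (V :&: dg (fun l => (b' l * a l) / (a' l * b l)) @: V) <= d)%N.
Proof.
move=> a0 b0 a'0 b'0 WV Va dir; set g := fun l => _.
pose e l := b' l / b l.
have e0 l : e l != 0 by rewrite mulf_neq0 ?invr_eq0.
pose Z := (dg (fun l => a' l * g l) @: V)%VS.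
have ZE : Z = (dg e @: (dg a @: V))%VS.
  by rewrite /Z dgM; apply: eq_dg => l; rewrite /e /g; field; rewrite a'0 b0.
have WE : (dg b' @: W = dg e @: (dg b @: W))%VS.
  by rewrite dgM; apply: eq_dg => l; rewrite /e; field; rewrite b0.
have dZ : \dim Z = \dim V by rewrite ZE !dim_dg.
have dY : (\dim V <= \dim (Z :&: dg b' @: W) + d)%N.
  have : (\dim (Z + dg b' @: W) <= \dim V + d)%N by rewrite ZE WE -limgD dim_dg.
  have := dimv_sum_cap Z (dg b' @: W); rewrite dZ dim_dg// WV; lia.
have <- : \dim (dg a' @: (V :&: dg g @: V)) = \dim (V :&: dg g @: V).
  exact: dim_dg.
set X := (dg a' @: _)%VS.
have XZ : (X <= Z)%VS by rewrite /X /Z -dgM limgS// capvSr.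
have XV : (X <= dg a' @: V)%VS by rewrite /X limgS// capvSl.
have XY0 : (X :&: (Z :&: dg b' @: W) = 0)%VS.
  apply/eqP; rewrite -subv0 -dir; apply: capvS => //; exact: capvSr.
have := dimv_sum_cap X (Z :&: dg b' @: W); rewrite XY0 dimv0.
have : (\dim (X + Z :&: dg b' @: W) <= \dim Z)%N.
  by apply: dimvS; rewrite subv_add XZ capvSl.
lia.
Qed.
End Diagonal.

(** * Zero sets of polynomial functions are null *)

Section PolynomialFunctions.
Variables (R : realType).

Inductive polyfun (n : nat) : (n.-tuple R -> R) -> Prop :=
| polyfun_cst c : polyfun (fun=> c)
| polyfun_tnth i : polyfun (fun x => tnth x i)
| polyfunD f g : polyfun f -> polyfun g -> polyfun (fun x => f x + g x)
| polyfunM f g : polyfun f -> polyfun g -> polyfun (fun x => f x * g x).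

Lemma polyfun_sum n (I : Type) (r : seq I) (f : I -> n.-tuple R -> R) :
  (forall i, polyfun (f i)) -> polyfun (fun x => \sum_(i <- r) f i x).
Proof.
move=> fP; elim: r => [|i r IHr].
  under eq_fun do rewrite big_nil; exact: polyfun_cst.
under eq_fun do rewrite big_cons; exact: polyfunD.
Qed.

Lemma polyfun_prod n (I : Type) (r : seq I) (f : I -> n.-tuple R -> R) :
  (forall i, polyfun (f i)) -> polyfun (fun x => \prod_(i <- r) f i x).
Proof.
move=> fP; elim: r => [|i r IHr].
  under eq_fun do rewrite big_nil; exact: polyfun_cst.
under eq_fun do rewrite big_cons; exact: polyfunM.
Qed.

Lemma polyfunX n (f : n.-tuple R -> R) k : polyfun f -> polyfun (fun x => f x ^+ k).
Proof.
move=> fP; elim: k => [|k IHk].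
  under eq_fun do rewrite expr0; exact: polyfun_cst.
under eq_fun do rewrite exprS; exact: polyfunM.
Qed.

Lemma polyfun_det n m (A : 'I_m -> 'I_m -> n.-tuple R -> R) :
  (forall i j, polyfun (A i j)) -> polyfun (fun x => \det (\matrix_(i, j) A i j x)).
Proof.
move=> AP; apply: polyfun_sum => s; apply: polyfunM; first exact: polyfun_cst.
apply: polyfun_prod => i; under eq_fun do rewrite mxE; exact: AP.
Qed.

Lemma measurable_polyfun n f : polyfun f -> measurable_fun [set: n.-tuple R] f.
Proof.
elim=> [c|i|f1 f2 _ m1 _ m2|f1 f2 _ m1 _ m2].
- exact: measurable_cst.
- exact: measurable_tnth.
- exact: measurable_funD.
- exact: measurable_funM.
Qed.

Lemma measurable_zero n (f : n.-tuple R -> R) :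
  polyfun f -> measurable [set x | f x = 0].
Proof.
move=> /measurable_polyfun mf; rewrite -[X in measurable X]setTI.
exact: (mf measurableT _ (measurable_set1 0)).
Qed.

Lemma polyfun_cons n (f : n.+1.-tuple R -> R) x :
  polyfun f -> polyfun (fun t => f [tuple of x :: t]).
Proof.
elim=> [c|i|f1 f2 _ m1 _ m2|f1 f2 _ m1 _ m2].
- exact: polyfun_cst.
- have [j ->|->] := unliftP ord0 i.
    under eq_fun do rewrite tnthS; exact: polyfun_tnth.
  exact: polyfun_cst.
- exact: polyfunD.
- exact: polyfunM.
Qed.

Lemma polyfun_head n (f : n.+1.-tuple R -> R) (t : n.-tuple R) : polyfun f ->
  exists p : {poly R}, forall x, f [tuple of x :: t] = p.[x].
Proof.
elim=> [c|i|f1 f2 _ [p pE] _ [q qE]|f1 f2 _ [p pE] _ [q qE]].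
- by exists c%:P => x; rewrite hornerC.
- have [j ->|->] := unliftP ord0 i.
    by exists (tnth t j)%:P => x; rewrite hornerC tnthS.
  by exists 'X => x; rewrite hornerX.
- by exists (p + q) => x; rewrite hornerD pE qE.
- by exists (p * q) => x; rewrite hornerM pE qE.
Qed.

Lemma lebesgue_measure_roots (p : {poly R}) : p != 0 ->
  measurable [set x | p.[x] = 0] /\ lebesgue_measure [set x | p.[x] = 0] = 0%E.
Proof.
move=> p0; have cp : countable [set x : R | p.[x] = 0].
  apply/finite_set_countable.
  have [s rs] : exists s : seq R, forall x, p.[x] = 0 -> x \in s.
    have [n] := ubnP (size p); elim: n p p0 => // n IHn p p0 pn.
    have [[a /eqP pa]|nr] := pselect (exists a, p.[a] = 0); last first.
      by exists [::] => x px; case: nr; exists x.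
    have /factor_theorem[q pE] : root p a by [].
    have q0 : q != 0 by apply: contraNneq p0 => q0; rewrite pE q0 mul0r.
    have [|s sP] := IHn q q0.
      by move: pn; rewrite pE size_Mmonic ?monicXsubC// size_XsubC addn2.
    exists (a :: s) => x; rewrite pE hornerM hornerXsubC => /eqP.
    rewrite mulf_eq0 inE subr_eq0 => /orP[/eqP/sP ->|->//]; exact: orbT.
  by apply: (sub_finite_set (B := [set` s])) => // x /rs.
split; [exact: countable_measurable|exact: countable_lebesgue_measure0].
Qed.

(** Fubini, by induction on [n]. With the other coordinates as in [t0], [f] is a nonzero polynomial
    [p] in the first one; off the finitely many roots of [p] the section is null by induction. *)
Lemma polyfun_null n (f : n.-tuple R -> R) t0 : polyfun f -> f t0 != 0 ->
  tuple_lebesgue R n [set x | f x = 0] = 0%E.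
Proof.
elim: n f t0 => [|n IHn] f t0 fP ft0.
  (* For n = 0 the measure is the point mass at the empty tuple, where [f] does not vanish. *)
  rewrite [LHS]diracE memNset//= => f0.
  by move: ft0; rewrite (tuple0 t0) f0 eqxx.
have [p pE] := polyfun_head [tuple of behead t0] fP.
have p0 : p != 0.
  apply: contraNneq ft0 => p0; rewrite {1}(tuple_eta t0).
  by rewrite -[X in f X]/[tuple of thead t0 :: [tuple of behead t0]] pE p0 horner0.
have [mp mup] := lebesgue_measure_roots p0.
have sec0 (x : R) : p.[x] <> 0 ->
    tuple_lebesgue R n [set t | f (tuple_of_pair (x, t)) = 0] = 0%E.
  move=> px; apply: (IHn _ [tuple of behead t0]); first exact: polyfun_cons.
  by rewrite pE; apply/eqP.
pose A := [set x : n.+1.-tuple R | f x = 0].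
have mA : measurable (@tuple_of_pair R n @^-1` A).
  rewrite -[X in measurable X]setTI; apply: measurable_tuple_of_pair => //.
  exact: measurable_zero.
rewrite -/A [LHS]/(\int[lebesgue_measure]_x
   (tuple_lebesgue R n (xsection (@tuple_of_pair R n @^-1` A) x)))%E.
rewrite -(@integral0 _ _ R lebesgue_measure setT).
apply: ge0_ae_eq_integral => //.
  exact: (measurable_fun_xsection (tuple_lebesgue R n) mA).
exists [set x | p.[x] = 0]; split=> // x /= /not_implyP[_ fx]; apply: contrapT => px.
apply: fx.
rewrite -[RHS](sec0 x px); congr (tuple_lebesgue R n _).
by apply/seteqP; split=> t; rewrite /xsection /= inE.
Qed.

Lemma ae_polyfun_neq0 (d : measure_display) (Omega : measurableType d)
    (P : probability Omega R) n (X : Omega -> n.-tuple R) f t0 :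
  measurable_fun [set: Omega] X -> has_density P X ->
  polyfun f -> f t0 != 0 -> {ae P, forall w, f (X w) != 0}.
Proof.
move=> mX [g [mg g0 gP]] fP ft0.
have mA := measurable_zero fP.
exists (X @^-1` [set x | f x = 0]); split.
- by rewrite -[X in measurable X]setTI; exact: mX.
- have := gP _ mA; rewrite /pushforward => ->.
  apply: null_set_integral => //.
    apply/measurable_EFinP; exact: measurable_funS mg.
  exact: polyfun_null fP ft0.
- by move=> w /= /negP; rewrite negbK => /eqP.
Qed.
End PolynomialFunctions.

(** * Interpolation by monomials in two variables *)

Section Interpolation.
Variables (R : numFieldType) (L n : nat).
Implicit Types (a b c d : 'I_L -> R).

(* Row l is the vector of monomials t^i s^j, i, j <= n, at t = a/b, s = c/d,
   with denominators cleared. *)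
Definition monomial_mx a b c d : 'M[R]_L :=
  \matrix_(l, k) (a l ^+ (k %% n.+1) * b l ^+ (n - k %% n.+1) *
                  (c l ^+ (k %/ n.+1) * d l ^+ (n - k %/ n.+1))).

(** The coefficients solve a linear system; the weights [w] undo the clearing of denominators. *)
Lemma interpolating_det a b c d : (L <= n.+1 * n.+1)%N ->
  (forall l, b l != 0) -> (forall l, d l != 0) ->
  \det (monomial_mx a b c d) != 0 ->
  interpolating n (fun l => a l / b l) (fun l => c l / d l).
Proof.
move=> Ln b0 d0 M0 l; pose w l := b l ^+ n * d l ^+ n.
have w0 l' : w l' != 0 by rewrite mulf_neq0 ?expf_neq0.
have Mu : monomial_mx a b c d \in unitmx by rewrite unitmxE unitfE.
have [y My] : exists y : 'cV_L, monomial_mx a b c d *m y = w l *: delta_mx l 0.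
  by exists (invmx (monomial_mx a b c d) *m (w l *: delta_mx l 0)); rewrite mulKVmx.
exists (fun k => y k 0) => l'; apply: (mulfI (w0 l')).
have := congr1 (fun z : 'cV_L => z l' 0) My; rewrite !mxE eqxx andbT => yE.
have -> : w l' * (l' == l)%:R = w l * (l' == l)%:R.
  by case: eqP => [->|] //; rewrite !mulr0.
rewrite -yE mulr_sumr; apply: eq_bigr => k _; rewrite [monomial_mx _ _ _ _ _ _]mxE.
have kn : (k %% n.+1 <= n)%N by rewrite -ltnS ltn_pmod.
have kn' : (k %/ n.+1 <= n)%N by rewrite -ltnS ltn_divLR//; exact: leq_trans Ln.
have bn : b l' ^+ n = b l' ^+ (n - k %% n.+1) * b l' ^+ (k %% n.+1).
  by rewrite -exprD subnK.
have dn : d l' ^+ n = d l' ^+ (n - k %/ n.+1) * d l' ^+ (k %/ n.+1).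
  by rewrite -exprD subnK.
rewrite /w bn dn !expr_div_n.
move: (expf_neq0 (k %% n.+1) (b0 l')) (expf_neq0 (k %/ n.+1) (d0 l')).
move: (b l' ^+ (k %% n.+1)) (d l' ^+ (k %/ n.+1)) => B D B0 D0.
by field; rewrite B0 D0.
Qed.

(** At s = t^(n+1) the k-th monomial is t^k, by division of k by n + 1, so the matrix is a
    transposed Vandermonde matrix with distinct nodes. *)
Lemma det_monomial_mx_neq0 :
  \det (monomial_mx (fun l => l.+1%:R) (fun=> 1) (fun l => l.+1%:R ^+ n.+1) (fun=> 1))
    != 0.
Proof.
rewrite -det_tr (_ : _^T = Vandermonde L (\row_(l < L) l.+1%:R)).
  rewrite det_Vandermonde; apply/prodf_neq0 => i _; apply/prodf_neq0 => j ij.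
  by rewrite !mxE subr_eq0 eqr_nat eqSS; apply: contraTneq ij => ->; rewrite ltnn.
apply/matrixP => k l; rewrite !mxE !expr1n !mulr1 -exprM -exprD.
by rewrite addnC mulnC -divn_eq.
Qed.
End Interpolation.

(** * Alignment loops among four users *)

Section Users.
Variables (R : realType) (K L : nat) (K4 : (4 <= K)%N).

Definition user (k : 'I_4) : 'I_K := widen_ord K4 k.

Notation u0 := (user (inord 0)).
Notation u1 := (user (inord 1)).
Notation u2 := (user (inord 2)).
Notation u3 := (user (inord 3)).

Lemma user_eq (i j : nat) : (i < 4)%N -> (j < 4)%N ->
  (user (inord i) == user (inord j)) = (i == j).
Proof. by move=> i4 j4; rewrite -val_eqE /= !inordK. Qed.

Definition gains := 'I_K -> 'I_K -> 'I_L -> R.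

(** Numerators and denominators of T, the loop through user 1 at receivers 0 and 3, and of S, the
    loop through user 3 at receivers 0 and 1. *)
Definition generic_det n (h : gains) : R :=
  \det (monomial_mx n (fun l => h u0 u1 l * h u3 u2 l) (fun l => h u0 u2 l * h u3 u1 l)
    (fun l => h u0 u3 l * h u1 u2 l) (fun l => h u0 u2 l * h u1 u3 l)).

Definition entry_gains (H : 'I_K -> 'I_K -> 'M[R]_L) : gains := fun i j l => H i j l l.

Section Deterministic.
Variable H : 'I_K -> 'I_K -> 'M[R]_L.
Hypothesis Hdiag : forall i j, is_diag_mx (H i j).
Let h := entry_gains H.
Hypothesis h0 : forall i j l, h i j l != 0.

Lemma mximg_dg i j (V : {vspace 'cV[R]_L}) :
  mximg (H i j) V = (dg (h i j) @: V)%VS.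
Proof.
rewrite /dg (_ : diag_mx _ = H i j)//; apply/matrixP => k l; rewrite !mxE.
case: eqVneq => [->|kl]; first by rewrite mulr1n.
by have /is_diag_mxP -> := Hdiag i j.
Qed.

(** The desired signal fills [D] dimensions at receiver [i], which leaves L - D for all interference
    together. *)
Lemma dim_interference V (D : nat) i j k :
  (forall i, \dim (V i) = D) -> decodable H V i -> j != i -> k != i ->
  (D + \dim (dg (h i j) @: V j + dg (h i k) @: V k) <= L)%N.
Proof.
move=> VD Vi ji ki; set W := (_ + _)%VS.
pose S := (\sum_(j | j != i) mximg (H i j) (V j))%VS.
have WS : (W <= S)%VS.
  by rewrite subv_add -!mximg_dg; apply/andP; split;
    [exact: (sumv_sup j)|exact: (sumv_sup k)].
have := dimv_sum_cap (mximg (H i i) (V i)) S; rewrite Vi dimv0 addn0.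
have := dimvS (subvf (mximg (H i i) (V i) + S)); rewrite dimvf /dim /= muln1.
have := dimvS WS; rewrite mximg_dg dim_dg// VD.
by move=> dWS dSL dSE; apply: leq_trans dSL; rewrite dSE leq_add2l.
Qed.

Lemma dim_direct V i j : decodable H V i -> j != i ->
  (dg (h i i) @: V i :&: dg (h i j) @: V j = 0)%VS.
Proof.
move=> Vi ji; apply/eqP; rewrite -subv0 -[0%VS]Vi -!mximg_dg.
by apply: capvS => //; exact: (sumv_sup j).
Qed.

Lemma achievable_deficit n D : (n * n < L)%N -> (L <= n.+1 * n.+1)%N ->
  generic_det n h != 0 -> achievable H D ->
  (2 * D <= L)%N /\ (L <= 121 * ((L - 2 * D) * (L - 2 * D)))%N.
Proof.
move=> nL Ln det0 [V [VD Vdec]]; set e := (L - 2 * D)%N.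
have inter i j k := @dim_interference V D i j k VD (Vdec i).
(* One interferer is taken twice; 2D <= L makes the truncated subtraction in [e] exact. *)
have DL : (2 * D <= L)%N.
  have := inter u0 u1 u1; rewrite addvv dim_dg// VD !user_eq//.
  by move=> /(_ isT isT); lia.
split=> //.
have near i j k : j != i -> k != i ->
    (\dim (dg (h i j) @: V j + dg (h i k) @: V k) <= \dim (V u2) + e)%N.
  by move=> ji ki; have := inter i j k ji ki; rewrite VD /e; lia.
have T : (\dim (V u2 + dg (fun l => (h u0 u1 l * h u3 u2 l) / (h u0 u2 l * h u3 u1 l))
    @: V u2) <= \dim (V u2) + (e + e))%N.
  apply: (@dim_loop _ _ (h u0 u2) (h u0 u1) (h u3 u2) (h u3 u1) _ (V u1)) => //.
  - by rewrite !VD.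
  - by apply: near; rewrite user_eq.
  - by apply: near; rewrite user_eq.
have S : (\dim (V u2 + dg (fun l => (h u0 u3 l * h u1 u2 l) / (h u0 u2 l * h u1 u3 l))
    @: V u2) <= \dim (V u2) + (e + e))%N.
  apply: (@dim_loop _ _ (h u0 u2) (h u0 u3) (h u1 u2) (h u1 u3) _ (V u3)) => //.
  - by rewrite !VD.
  - by apply: near; rewrite user_eq.
  - by apply: near; rewrite user_eq.
have C : (\dim (V u2 :&: dg (fun l => (h u2 u1 l * h u0 u2 l) / (h u2 u2 l * h u0 u1 l))
    @: V u2) <= e)%N.
  apply: (@dim_cap_direct _ _ (h u0 u2) (h u0 u1) (h u2 u2) (h u2 u1) _ (V u1)) => //.
  - by rewrite !VD.
  - by apply: near; rewrite user_eq.
  - by apply: dim_direct => //; rewrite user_eq.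
have hM0 i j i' j' l : h i j l * h i' j' l != 0 by rewrite mulf_neq0.
have ts := interpolating_det Ln
  (fun l => hM0 u0 u2 u3 u1 l) (fun l => hM0 u0 u2 u1 u3 l) det0.
have g0 l : h u2 u1 l * h u0 u2 l / (h u2 u2 l * h u0 u1 l) != 0.
  by rewrite mulf_neq0 ?invr_eq0.
have := dim_le_cap_dg Ln ts g0 T S.
rewrite VD => Dle.
have {Dle} : (D <= e + (e + e) * (e + e) + (n + n) * (e + e))%N.
  by apply: leq_trans Dle _; rewrite !leq_add2r.
have : (L = 2 * D + e)%N by rewrite /e; lia.
(* If L > 121 e^2, then n^2 < L gives 11ne < L, and L = 2D + e <= 3e + 8e^2 + 8ne <= 11e^2 + 8ne <
   9L/11, a contradiction. *)
move: nL; clear; move: e => e nL LE De; rewrite leqNgt; apply/negP => eL.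
have nm : ((11 * (n * e)) * (11 * (n * e)) < L * L)%N.
  have := ltn_mul nL eL; lia.
have ne : (11 * (n * e) < L)%N.
  by rewrite ltnNge; apply/negP => Lne; have := leq_mul Lne Lne; lia.
have e2 : (e <= e * e)%N by case: e {De LE eL nm ne} => // e; rewrite leq_pmulr.
lia.
Qed.
End Deterministic.

Definition tuple_gains (x : #|{: 'I_K * 'I_K * 'I_L}|.-tuple R) : gains :=
  fun i j l => tnth x (enum_rank (i, j, l)).

Lemma tuple_gains_entries H : tuple_gains (diagonal_entries H) = entry_gains H.
Proof.
apply/funext => i; apply/funext => j; apply/funext => l.
by rewrite /tuple_gains (tnth_nth 0) nth_codom enum_rankK.
Qed.

(** A single polynomial for two conditions: the monomials interpolate and no gain vanishes. *)
Definition genericity n (x : #|{: 'I_K * 'I_K * 'I_L}|.-tuple R) : R :=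
  generic_det n (tuple_gains x) * \prod_k tnth x k.

Lemma polyfun_genericity n : polyfun (genericity n).
Proof.
apply: polyfunM; last by apply: polyfun_prod => k; exact: polyfun_tnth.
apply: polyfun_det => l k.
by do 2 apply: polyfunM; do ?apply: polyfunM; apply: polyfunX; apply: polyfunM;
  exact: polyfun_tnth.
Qed.

Lemma genericity_neq0 n : exists x, genericity n x != 0.
Proof.
(* These gains reduce [generic_det] to the Vandermonde case; nodes starting at 1 keep every gain
   nonzero. *)
pose g (p : 'I_K * 'I_K * 'I_L) : R :=
  if p.1.1 == u0 then
    if p.1.2 == u1 then p.2.+1%:R else
    if p.1.2 == u3 then p.2.+1%:R ^+ n.+1 else 1
  else 1.
exists [tuple g (enum_val k) | k < _].
have gE i j l : tuple_gains [tuple g (enum_val k) | k < _] i j l = g (i, j, l).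
  by rewrite /tuple_gains tnth_mktuple enum_rankK.
apply: mulf_neq0; last first.
  apply/prodf_neq0 => k _; rewrite tnth_mktuple /g.
  by do 3 ?case: ifP => _; rewrite ?oner_neq0 ?expf_neq0 ?pnatr_eq0.
rewrite /generic_det [monomial_mx _ _ _ _ _](_ : _ = monomial_mx n
  (fun l => l.+1%:R) (fun=> 1) (fun l => l.+1%:R ^+ n.+1) (fun=> 1)).
  exact: det_monomial_mx_neq0.
by apply/matrixP => l k; rewrite !mxE !gE /g /= !user_eq //= !mulr1.
Qed.
End Users.

(** * From the deficit L - 2D to the degrees of freedom *)

Lemma ex_ceil_sqrt L : (0 < L)%N -> exists n, (n * n < L)%N /\ (L <= n.+1 * n.+1)%N.
Proof.
move=> L0; have ex : exists n, (L <= n.+1 * n.+1)%N by exists L; lia.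
have [[|n] nL nmin] := ex_minnP ex; first by exists 0%N.
by exists n.+1; split=> //; rewrite ltnNge; apply/negP => /nmin; rewrite ltnn.
Qed.

(** With e = L - 2D and s = sqrt L, KD/L = (K/2)(1 - e/s^2), and s <= 11e gives e/s^2 >= 1/(11s). *)
Lemma deficit_bound (R : realType) (K L D : nat) : (0 < L)%N -> (2 * D <= L)%N ->
  (L <= 121 * ((L - 2 * D) * (L - 2 * D)))%N ->
  (K * D)%:R / L%:R <= K%:R / 2 * (1 - 1 / (11 * Num.sqrt L%:R)) :> R.
Proof.
move=> L0 DL Le; set s := Num.sqrt _.
have s0 : 0 < s by rewrite sqrtr_gt0 ltr0n.
have sE : L%:R = s ^+ 2 by rewrite sqr_sqrtr.
have LE : L%:R = 2 * D%:R + (L - 2 * D)%:R :> R by rewrite -natrM -natrD subnKC.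
move: (L - 2 * D)%N Le LE => e Le LE.
have se : s <= 11 * e%:R.
  rewrite -(@ler_pXn2r _ 2)// ?nnegrE ?mulr_ge0// ?(ltW s0)// -sE.
  rewrite (_ : (11 * e%:R) ^+ 2 = 121 * (e%:R * e%:R)); last by ring.
  by move: Le; rewrite -(ler_nat R) !natrM.
have DE : D%:R = (s ^+ 2 - e%:R) / 2 :> R by lra.
have -> : (K * D)%:R / L%:R = K%:R / 2 * (1 - e%:R / s ^+ 2).
  by rewrite natrM DE sE; field; rewrite gt_eqF.
apply: ler_wpM2l; first by rewrite divr_ge0.
rewrite lerD2l lerN2 ler_pdivrMr; last by rewrite mulr_gt0.
rewrite mulrAC ler_pdivlMr ?exprn_gt0// mul1r expr2.
nra.
Qed.

Theorem theorem1 (R : realType) (K L : nat) (hK : (4 <= K)%N) (hL : (1 <= L)%N)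
    (d : measure_display) (Omega : measurableType d) (P : probability Omega R)
    (H : Omega -> 'I_K -> 'I_K -> 'M[R]_L)
    (Hmeas : forall (i j : 'I_K) (l : 'I_L),
      measurable_fun [set: Omega] (fun w : Omega => H w i j l l))
    (Hdiag : forall (w : Omega) (i j : 'I_K), is_diag_mx (H w i j))
    (Hdens : has_density P (fun w : Omega => diagonal_entries (H w))) :
  {ae P, forall w : Omega,
    DoF (H w) <= K%:R / 2 * (1 - 1 / (11 * Num.sqrt L%:R))}.
Proof.
have [n [nL Ln]] := ex_ceil_sqrt hL.
have [x0 x0P] := genericity_neq0 R L hK n.
have mX : measurable_fun [set: Omega] (fun w => diagonal_entries (H w)).
  apply/measurable_fun_tnthP => k.
  have [p ->] : exists p, k = enum_rank p by exists (enum_val k); rewrite enum_valK.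
  rewrite (_ : _ \o _ = fun w => H w p.1.1 p.1.2 p.2 p.2) //.
  by apply/funext => w; rewrite /= (tnth_nth 0) nth_codom enum_rankK.
(* Randomness enters only here: off a null set the channel is generic, and the rest is
   deterministic. *)
have := ae_polyfun_neq0 mX Hdens (polyfun_genericity R L hK n) x0P.
apply: filterS => w; rewrite /genericity mulf_eq0 negb_or => /andP[det0 /prodf_neq0 ent0].
have K0 : (0 < K)%N by exact: (leq_trans _ hK).
have [[D aD ->] _] := DoF_max (H w) K0.
have h0 i j l : entry_gains (H w) i j l != 0.
  by rewrite -tuple_gains_entries; exact: ent0.
rewrite tuple_gains_entries in det0.
have [DL Le] := achievable_deficit (Hdiag w) h0 nL Ln det0 aD.
exact: deficit_bound.
Qed.
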